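(* Let $\mathbb V$ be a linear space with an $n$-linear map $f:\mathbb V\times\cdots\times\mathbb V\to\mathbb V$ and a fixed basis $\mathcal B=\{e_i:i\in I\}$, and let $\mathbb V=\bigoplus_{[V_{[e_i]}]\in\mathcal F/\approx}\overbrace{V_{[e_i]}}$ be the $f$-orthogonal decomposition into strongly $f$-invariant subspaces constructed from $f$ and $\mathcal B$ in the context. For any component $\overbrace{V_{[e_i]}}$, let $f':\overbrace{V_{[e_i]}}\times\cdots\times\overbrace{V_{[e_i]}}\to\overbrace{V_{[e_i]}}$ be the restriction of $f$, and let $\mathcal B'=\mathcal B\cap\overbrace{V_{[e_i]}}$, a basis of $\overbrace{V_{[e_i]}}$. Then the linear space $\overbrace{V_{[e_i]}}$ is $f'$-simple if and only if $\mathrm{Ann}(f')=0$ and $\mathcal B'$ is an $i$-division basis of $\overbrace{V_{[e_i]}}$ with respect to $f'$.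
   Context: Linear spaces are over an arbitrary field $\mathbb F$ and of arbitrary dimension; $n\ge 2$; $f:\mathbb V\times\cdots\times\mathbb V\to\mathbb V$ ($n$ factors) is $n$-linear. A superscript $(k)$ marks the $k$-th entry of $f$: $f(\mathbb V,\dots,W^{(k)},\dots,\mathbb V)$ is the span of all values of $f$ with $k$-th entry in $W$ and all other entries in $\mathbb V$, and $f(\mathbb V,\dots,V_1^{(k_1)},\dots,V_2^{(k_2)},\dots,\mathbb V)$ is the span of all values with $k_1$-th entry in $V_1$, $k_2$-th entry in $V_2$ and the other entries in $\mathbb V$. Subspaces $V_1,V_2$ are $f$-orthogonal if $f(\mathbb V,\dots,V_1^{(i)},\dots,V_2^{(j)},\dots,\mathbb V)=0$ for all $i\ne j$ in $\{1,\dots,n\}$; a direct sum decomposition is $f$-orthogonal if its distinct summands are pairwise $f$-orthogonal. A subspace $W$ is strongly $f$-invariant if $f(\mathbb V,\dots,W^{(i)},\dots,\mathbb V)\subset W$ for all $i\in\{1,\dots,n\}$. The space $\mathbb V$ is $f$-simple if $f(\mathbb V,\dots,\mathbb V)\ne0$ and its only strongly $f$-invariant subspaces are $\{0\}$ and $\mathbb V$. $\mathrm{Ann}(f)=\{v\in\mathbb V: f(\mathbb V,\dots,v^{(i)},\dots,\mathbb V)=0\text{ for all }i\in\{1,\dots,n\}\}$. For $v\in \mathbb V$, $\mathcal I(v)$ denotes the strongly $f$-invariant subspace generated by $v$, i.e. the minimal strongly $f$-invariant subspace of $\mathbb V$ containing $v$. A basis $\mathcal B$ of $\mathbb V$ is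 an $i$-division basis with respect to $f$ if for any $e\in\mathcal B$ and $b_1,\dots,b_{n-1}\in\mathbb V$ such that $f(b_1,\dots,e^{(k)},\dots,b_{n-1})=w\ne0$ for some $k\in\{1,\dots,n\}$ ($e$ in the $k$-th entry, the $b$'s filling the others in order), one has $e,b_1,\dots,b_{n-1}\in\mathcal I(w)$. (In ''$i$-division'' the letter $i$ is part of the name.) All these notions are applied to $\overbrace{V_{[e_i]}}$ and $f'$ with $(\overbrace{V_{[e_i]}},f')$ in place of $(\mathbb V,f)$. Construction from a basis $\mathcal B$. For each $e\in\mathcal B$ introduce a symbol $\overline e\notin\mathcal B$; $\overline{\mathcal B}=\{\overline e:e\in\mathcal B\}$, $\overline{(\overline e)}:=e$. Let $\mathbb V^*=\mathbb V\setminus\{0\}$ and $\mathcal P(\mathbb V^* )$ its power set. Define $F:\mathcal P(\mathbb V^* )\times(\mathcal B\dot\cup\overline{\mathcal B})^{n-1}\to\mathcal P(\mathbb V^* )$ as follows: $F(\emptyset,\dots)=\emptyset$; for $U\ne\emptyset$ and $\xi_1,\dots,\xi_{n-1}\in\mathcal B$, $$F(U,\xi_1,\dots,\xi_{n-1})=\Big(\bigcup_{1\le k\le n,\ \sigma\in\mathbb S_{n-1}}\{f(\xi_{\sigma(1)},\dots,u^{(k)},\dots,\xi_{\sigma(n-1)}):u\in U\}\Big)\setminus\{0\},$$ $$F(U,\overline\xi_1,\dots,\overline\xi_{n-1})=\Big(\bigcup_{1\le k\le n,\ \sigma\in\mathbb S_{n-1}}\{u\in\mathbb V:f(\xi_{\sigma(1)},\dots,u^{(k)},\dots,\xi_{\sigma(n-1)})\in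 U\}\Big)\setminus\{0\},$$ where $u$ is in the $k$-th entry and the remaining entries are filled in order by $\xi_{\sigma(1)},\dots,\xi_{\sigma(n-1)}$; and $F(U,\dots)=\emptyset$ if among the last $n-1$ arguments there is one in $\mathcal B$ and one in $\overline{\mathcal B}$. $e_i\in\mathcal B$ is connected to $e_j\in\mathcal B$ (written $e_i\sim e_j$) if $e_i=e_j$ or there is an ordered list $(X_1,\dots,X_m)$, $m\ge1$, of $(n-1)$-tuples $X_r\in(\mathcal B\dot\cup\overline{\mathcal B})^{n-1}$ such that $F(\{e_i\},X_1)\ne\emptyset$, $F(F(\{e_i\},X_1),X_2)\neq\emptyset$, ..., $F(\dots F(F(\{e_i\},X_1),X_2)\dots,X_{m-1})\ne\emptyset$ and $e_j\in F(F(\dots F(F(\{e_i\},X_1),X_2)\dots,X_{m-1}),X_m)$. This is an equivalence relation on $\mathcal B$; $[e_i]$ is the class of $e_i$, $V_{[e_i]}:=\bigoplus_{e_j\in[e_i]}\mathbb F e_j$, so $\mathbb V=\bigoplus_{[e_i]\in\mathcal B/\sim}V_{[e_i]}$, and $\Pi_{V_{[e_i]}}:\mathbb V\to V_{[e_i]}$ is the associated projection. Let $\mathcal F=\{V_{[e_i]}:[e_i]\in\mathcal B/\sim\}$. Put $V_{[e_i]}\approx V_{[e_j]}$ iff $V_{[e_i]}=V_{[e_j]}$ or there is $\{[\xi_1],\dots,[\xi_m]\}\subset\mathcal B/\sim$ with $[\xi_1]=[e_i]$, $[\xi_m]=[e_j]$ and, for each $r=1,\dots,m-1$, $$\sum_{1\le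 k_1<k_2\le n}\Big[\Pi_{V_{[\xi_r]}}\big(f(\mathbb V,\dots,V_{[\xi_{r+1}]}^{(k_1)},\dots,V_{[\xi_{r+1}]}^{(k_2)},\dots,\mathbb V)\big)+\Pi_{V_{[\xi_{r+1}]}}\big(f(\mathbb V,\dots,V_{[\xi_r]}^{(k_1)},\dots,V_{[\xi_r]}^{(k_2)},\dots,\mathbb V)\big)\Big]\ne0$$ (a sum of linear subspaces). This is an equivalence relation on $\mathcal F$; $[V_{[e_i]}]$ denotes the class of $V_{[e_i]}$, and $\overbrace{V_{[e_i]}}:=\bigoplus_{V_{[e_j]}\in[V_{[e_i]}]}V_{[e_j]}$. *)

(* Defs.v *)
From HB Require Import structures.
From mathcomp Require Import all_boot all_order all_algebra all_fingroup.
From mathcomp Require Import boolp classical_sets.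

Set Implicit Arguments.
Unset Strict Implicit.
Unset Printing Implicit Defensive.

Import GRing.Theory.
Local Open Scope classical_set_scope.
Local Open Scope ring_scope.

Section LinearSpaces.
Variables (F : fieldType) (V : lmodType F).
Implicit Types (A B W U : set V) (v : V).

Definition is_subspace W : Prop := GRing.submod_closed (mem W).

Definition lspan A : set V := smallest is_subspace A.

Definition sumspace (D : set (set V)) : set V := lspan (\bigcup_(U in D) U).

Definition lin_indep B : Prop :=
  forall s : seq V, uniq s -> (forall v, v \in s -> B v) ->
  forall a : V -> F, \sum_(v <- s) a v *: v = 0 -> forall v, v \in s -> a v = 0.

Definition is_basis B : Prop := lin_indep B /\ lspan B = setT.

(* The projection onto the summand U along the sum of the other summands of the
   direct decomposition D; xget returns the unique such p. *)
Definition summand_proj (D : set (set V)) U v : V :=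
  xget 0 [set p | U p /\ sumspace (D `\ U) (v - p)].

Lemma subspaceP W :
  is_subspace W <-> W 0 /\ forall a u v, W u -> W v -> W (a *: u + v).
Proof.
split=> [[h0 h]|[h0 h]]; split.
- by move: h0; rewrite inE.
- by move=> a u v uW vW; have := h a u v; rewrite !inE; apply.
- by rewrite inE.
- by move=> a u v; rewrite !inE; apply: h.
Qed.

Lemma span_subspace A : is_subspace (lspan A).
Proof.
apply/subspaceP; split=> [W [/subspaceP[]//]|a u v hu hv W hW].
by case: (hW) => /subspaceP[_ h] _; apply: h; [apply: hu|apply: hv].
Qed.

Definition span_pred A : {pred V} := mem (lspan A).

Lemma span_pred_submod A : GRing.submod_closed (span_pred A).
Proof. exact: span_subspace. Qed.

HB.instance Definition _ A :=
  GRing.isSubmodClosed.Build F V (span_pred A) (span_pred_submod A).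

(* the subspace lspan A as a type carrying its own linear space structure *)
Record span_type A := SpanVec { span_val : V; _ : span_val \in span_pred A }.

HB.instance Definition _ A := [isSub for @span_val A].
HB.instance Definition _ A := [Choice of span_type A by <:].
HB.instance Definition _ A :=
  [SubChoice_isSubLmodule of span_type A by <:].

End LinearSpaces.

Section MultilinearMaps.
Variables (F : fieldType) (V : lmodType F) (n : nat).
Implicit Types (f : ('I_n -> V) -> V) (W : set V) (k : 'I_n).

(* u in the k-th entry, the remaining entries filled in order by the b's *)
Definition insert_at k (u : V) (b : 'I_n.-1 -> V) : 'I_n -> V :=
  fun i => if unlift k i is Some j then b j else u.

Definition multilinear f : Prop :=
  forall k (b : 'I_n.-1 -> V) (a : F) (u v : V),
    f (insert_at k (a *: u + v) b) =
      a *: f (insert_at k u b) + f (insert_at k v b).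

(* f(S_1, ..., S_n), the span of all values with i-th entry in S_i *)
Definition fspan f (S : 'I_n -> set V) : set V :=
  lspan (f @` [set a | forall i, S i (a i)]).

Definition slot k W : 'I_n -> set V := fun i => if i == k then W else setT.

Definition slot2 k1 W1 k2 W2 : 'I_n -> set V :=
  fun i => if i == k1 then W1 else if i == k2 then W2 else setT.

Definition strongly_invariant f W : Prop :=
  is_subspace W /\ forall k, fspan f (slot k W) `<=` W.

Definition f_simple f : Prop :=
  fspan f (fun=> setT) <> [set 0] /\
  forall W, strongly_invariant f W -> W = [set 0] \/ W = setT.

Definition Ann f : set V :=
  [set v | forall k, fspan f (slot k [set v]) = [set 0]].

(* I(v) *)
Definition ideal_gen f (v : V) : set V :=
  smallest (strongly_invariant f) [set v].

Definition i_division f (B : set V) : Prop :=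
  forall (e : V) (b : 'I_n.-1 -> V) k, B e -> f (insert_at k e b) <> 0 ->
    ideal_gen f (f (insert_at k e b)) e /\
    forall j, ideal_gen f (f (insert_at k e b)) (b j).

Definition i_division_basis f (B : set V) : Prop :=
  is_basis B /\ i_division f B.

Definition restriction f (A : set V)
    (fA : forall a, (forall i, lspan A (a i)) -> lspan A (f a)) :
    ('I_n -> span_type A) -> span_type A :=
  fun a => @SpanVec F V A (f (fun i => val (a i)))
             (mem_set (fA _ (fun i => set_mem (valP (a i))))).

End MultilinearMaps.

Section Construction.
Variables (F : fieldType) (V : lmodType F) (n : nat).
Variables (f : ('I_n -> V) -> V) (B : set V).
Implicit Types (U c d : set V) (e : V).

(* The disjoint union of B and its copy of barred symbols is B + B, with
   inl for the plain and inr for the barred symbols. *)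
Definition symbol : Type := (B + B)%type.

Definition permuted (xi : 'I_n.-1 -> B) (s : 'S_n.-1) : 'I_n.-1 -> V :=
  fun j => val (xi (s j)).

Definition Fplain U (xi : 'I_n.-1 -> B) : set V :=
  [set v | exists k s, exists2 u, U u & v = f (insert_at k u (permuted xi s))]
    `\ 0.

Definition Fbar U (xi : 'I_n.-1 -> B) : set V :=
  [set u | exists k s, U (f (insert_at k u (permuted xi s)))] `\ 0.

(* empty when X mixes plain and barred symbols, and when U is empty *)
Definition Fop U (X : 'I_n.-1 -> symbol) : set V :=
  [set v | (exists2 xi, X = (fun j => inl (xi j)) & Fplain U xi v) \/
           (exists2 xi, X = (fun j => inr (xi j)) & Fbar U xi v)].

Definition Fiter U (Xs : seq ('I_n.-1 -> symbol)) : set V := foldl Fop U Xs.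

Definition conn e e' : Prop :=
  e = e' \/
  exists Xs : seq ('I_n.-1 -> symbol),
    [/\ (0 < size Xs)%N,
        forall r, (0 < r < size Xs)%N -> Fiter [set e] (take r Xs) !=set0 &
        Fiter [set e] Xs e'].

Definition conn_class e : set V := [set e' | B e' /\ conn e e'].

Definition classes : set (set V) := conn_class @` B.

(* V_[e] is lspan (conn_class e) *)
Definition summands : set (set V) := (@lspan F V) @` classes.

Definition linked c d : Prop :=
  sumspace
    [set W | exists k1 k2 : 'I_n, (k1 < k2)%N /\
       (W = summand_proj summands (lspan c) @`
              fspan f (slot2 k1 (lspan d) k2 (lspan d)) \/
        W = summand_proj summands (lspan d) @`
              fspan f (slot2 k1 (lspan c) k2 (lspan c)))]
  <> [set 0].

Definition approx e e' : Prop :=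
  lspan (conn_class e) = lspan (conn_class e') \/
  exists (m : nat) (c : nat -> set V),
    [/\ forall r, (r <= m)%N -> classes (c r),
        c 0%N = conn_class e, c m = conn_class e' &
        forall r, (r < m)%N -> linked (c r) (c r.+1)].

Definition approx_class e : set (set V) :=
  [set lspan (conn_class e') | e' in [set e' | B e' /\ approx e e']].

Definition component_gens e : set V := \bigcup_(U in approx_class e) U.

Definition component_of e : set V := lspan (component_gens e).

End Construction.

Section LinearSpaceLemmas.
Variables (F : fieldType) (V : lmodType F).
Implicit Types (A B W U : set V) (v : V).

Lemma sub_span A : A `<=` lspan A.
Proof. exact: sub_gen_smallest. Qed.

Lemma span_min A W : is_subspace W -> A `<=` W -> lspan A `<=` W.
Proof. exact: smallest_sub. Qed.

Lemma lspan_mono A W : A `<=` W -> lspan A `<=` lspan W.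
Proof.
move=> h; apply: span_min; first exact: span_subspace.
by move=> x /h; apply: sub_span.
Qed.

Lemma subspace0 W : is_subspace W -> W 0.
Proof. by case/subspaceP. Qed.

Lemma subspaceZD W a u v : is_subspace W -> W u -> W v -> W (a *: u + v).
Proof. by case/subspaceP=> _; apply. Qed.

Lemma subspaceD W u v : is_subspace W -> W u -> W v -> W (u + v).
Proof. by move=> sW uW vW; rewrite -[u]scale1r; apply: subspaceZD. Qed.

Lemma subspaceZ W a u : is_subspace W -> W u -> W (a *: u).
Proof.
by move=> sW uW; rewrite -[_ *: _]addr0; apply: subspaceZD => //; apply: subspace0.
Qed.

Lemma subspaceB W u v : is_subspace W -> W u -> W v -> W (u - v).
Proof.
by move=> sW uW vW; rewrite addrC -scaleN1r; apply: subspaceZD.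
Qed.

Lemma span_comb A v : lspan A v -> exists (s : seq V) (a : V -> F),
  [/\ uniq s, forall x, x \in s -> A x, forall x, x \notin s -> a x = 0 &
      v = \sum_(x <- s) a x *: x].
Proof.
pose P v := exists (s : seq V) (a : V -> F),
  [/\ uniq s, forall x, x \in s -> A x, forall x, x \notin s -> a x = 0 &
      v = \sum_(x <- s) a x *: x].
have ext s t (a : V -> F) : uniq s -> uniq t -> {subset s <= t} ->
    (forall x, x \notin s -> a x = 0) ->
    \sum_(x <- s) a x *: x = \sum_(x <- t) a x *: x.
  move=> us ut st h; rewrite [RHS](bigID (mem s)) /= [X in _ + X]big1 ?addr0.
    rewrite -[RHS]big_filter; apply: perm_big; apply: uniq_perm => //.
      exact: filter_uniq.
    by move=> x; rewrite mem_filter; case: (boolP (x \in s)) => // /st ->.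
  by move=> x /h ->; rewrite scale0r.
apply: (@span_min A P); last first.
  move=> x Ax; exists [:: x], (fun y => if y == x then 1 else 0); split=> //.
  - by move=> y; rewrite inE => /eqP->.
  - by move=> y; rewrite inE => /negbTE->.
  - by rewrite big_seq1 eqxx scale1r.
apply/subspaceP; split.
  by exists [::], (fun=> 0); split=> //; rewrite big_nil.
move=> c _ _ [s [a [us sA a0 ->]]] [t [b [ut tA b0 ->]]].
have sub1 : {subset s <= undup (s ++ t)}.
  by move=> x xs; rewrite mem_undup mem_cat xs.
have sub2 : {subset t <= undup (s ++ t)}.
  by move=> x xs; rewrite mem_undup mem_cat xs orbT.
exists (undup (s ++ t)), (fun x => c * a x + b x); split.
- exact: undup_uniq.
- by move=> x; rewrite mem_undup mem_cat => /orP[/sA|/tA].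
- move=> x; rewrite mem_undup mem_cat negb_or => /andP[/a0-> /b0->].
  by rewrite mulr0 addr0.
- rewrite (ext s (undup (s ++ t))) ?undup_uniq //.
  rewrite (ext t (undup (s ++ t))) ?undup_uniq //.
  rewrite scaler_sumr -big_split /=; apply: eq_bigr => x _.
  by rewrite scalerDl scalerA.
Qed.

Lemma span_disjoint B A1 A2 v : lin_indep B -> A1 `<=` B -> A2 `<=` B ->
  (forall x, A1 x -> A2 x -> False) -> lspan A1 v -> lspan A2 v -> v = 0.
Proof.
move=> lB s1 s2 dis /span_comb[s [a [us sA a0 ve]]] /span_comb[t [b [ut tA b0 ve2]]].
have d x : x \in s -> x \notin t.
  by move=> xs; apply/negP => xt; exact: (dis x (sA _ xs) (tA _ xt)).
have d2 x : x \in t -> x \notin s.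
  by move=> xs; apply/negP => xt; move: (d _ xt); rewrite xs.
have key : forall x, x \in s ++ t -> a x - b x = 0.
  apply: (lB (s ++ t)).
  - rewrite cat_uniq us ut andbT /=; apply/negP => /hasP[x xt xs].
    by move: (d _ xs); rewrite xt.
  - by move=> x; rewrite mem_cat => /orP[/sA/s1|/tA/s2].
  - rewrite big_cat /= (eq_big_seq (fun x => a x *: x)); last first.
      by move=> x /d/b0 /= ->; rewrite subr0.
    rewrite [X in _ + X](eq_big_seq (fun x => - (b x *: x))); last first.
      by move=> x /d2/a0 /= ->; rewrite sub0r scaleNr.
    by rewrite sumrN -ve -ve2 subrr.
rewrite ve big_seq big1 // => x xs.
have := key x; rewrite mem_cat xs => /(_ isT).
by rewrite (b0 x (d _ xs)) subr0 => ->; rewrite scale0r.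
Qed.

Lemma basis_neq0 B e : lin_indep B -> B e -> e <> 0.
Proof.
move=> lB Be e0.
have h : forall v, v \in [:: e] -> (1 : F) = 0.
  apply: (lB [:: e] isT _ (fun=> 1)).
    by move=> v; rewrite inE => /eqP->.
  by rewrite big_seq1 e0 scaler0.
by have /eqP := h e (mem_head _ _); rewrite oner_eq0.
Qed.

Lemma span_basis_mem B A e : lin_indep B -> A `<=` B -> B e -> lspan A e -> A e.
Proof.
move=> lB AB Be eA; apply: contrapT => nAe.
apply: (basis_neq0 lB Be); apply: (@span_disjoint B A [set e]) => //.
- by move=> _ ->.
- by move=> x Ax xe; apply: nAe; rewrite -xe.
- exact: sub_span.
Qed.

End LinearSpaceLemmas.

Section MultilinearLemmas.
Variables (F : fieldType) (V : lmodType F) (n : nat).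
Implicit Types (f : ('I_n -> V) -> V) (W : set V) (k : 'I_n).

Lemma insertE k a : insert_at k (a k) (fun j => a (lift k j)) = a :> ('I_n -> V).
Proof. by apply: funext => i; rewrite /insert_at; case: unliftP => [j ->|->]. Qed.

Lemma insert_id k u (b : 'I_n.-1 -> V) : insert_at k u b k = u.
Proof. by rewrite /insert_at unlift_none. Qed.

Lemma insert_lift k u (b : 'I_n.-1 -> V) j : insert_at k u b (lift k j) = b j.
Proof. by rewrite /insert_at liftK. Qed.

Lemma multilinear_span f (S : 'I_n -> set V) W : multilinear f -> is_subspace W ->
  (forall a, (forall i, S i (a i)) -> W (f a)) ->
  forall a, (forall i, lspan (S i) (a i)) -> W (f a).
Proof.
move=> fl sW h.
suff H m : forall a, (forall i : 'I_n, (i < m)%N -> lspan (S i) (a i)) ->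
    (forall i : 'I_n, (m <= i)%N -> S i (a i)) -> W (f a).
  move=> a ha; apply: (H n) => // i; by rewrite leqNgt ltn_ord.
elim: m => [|m IH] a h1 h2; first by apply: h => i; apply: h2.
case: (ltnP m n) => [mn|nm]; last first.
  apply: IH => i im; first by apply: h1; apply: ltnW.
  by move: (leq_trans nm im); rewrite leqNgt ltn_ord.
pose k := Ordinal mn; pose b j := a (lift k j).
have : (fun u => W (f (insert_at k u b))) (a k); last by rewrite insertE.
apply: (@span_min _ _ (S k) (fun u => W (f (insert_at k u b)))).
- apply/subspaceP; split.
    have := fl k b (-1) 0 0; rewrite scaler0 addr0 scaleN1r addNr => ->.
    exact: subspace0.
  by move=> c u v uW vW; rewrite fl; apply: subspaceZD.
- move=> u uS; apply: IH => i; case: (eqVneq i k) => [->|ik].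
  + by rewrite ltnn.
  + move=> im; have -> : insert_at k u b i = a i.
      by rewrite /insert_at; case: unliftP ik => [j ->|->] //; rewrite eqxx.
    by apply: h1; apply: ltnW.
  + by rewrite insert_id.
  + move=> im; have -> : insert_at k u b i = a i.
      by rewrite /insert_at; case: unliftP ik => [j ->|->] //; rewrite eqxx.
    by apply: h2; rewrite ltn_neqAle im andbT eq_sym.
- by apply: h1.
Qed.
End MultilinearLemmas.

Section ComponentLemmas.
Variables (F : fieldType) (V : lmodType F) (n : nat).
Variables (f : ('I_n -> V) -> V) (B : set V).
Implicit Types (U c d : set V) (e : V).
Local Notation Fop := (@Fop F V n f B).
Local Notation Fiter := (@Fiter F V n f B).
Local Notation conn := (@conn F V n f B).
Local Notation conn_class := (@conn_class F V n f B).
Local Notation summands := (@summands F V n f B).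
Local Notation classes := (@classes F V n f B).

Lemma FopP U X v : Fop U X v -> exists2 u, U u & Fop [set u] X v.
Proof.
case=> [[xi -> [[k [s [u Uu ->]]] v0]]|[xi -> [[k [s Us]] v0]]].
- exists u => //; left; exists xi => //; split=> //.
  by exists k, s, u.
- exists (f (insert_at k v (permuted xi s))) => //; right; exists xi => //.
  by split=> //; exists k, s.
Qed.

Lemma Fop_sub U U' X : U `<=` U' -> Fop U X `<=` Fop U' X.
Proof.
move=> sU v [[xi -> [[k [s [u Uu ->]]] v0]]|[xi -> [[k [s Us]] v0]]].
- by left; exists xi => //; split=> //; exists k, s, u => //; apply: sU.
- by right; exists xi => //; split=> //; exists k, s; apply: sU.
Qed.

Lemma Fop_neq0 U X v : Fop U X v -> v <> 0.
Proof. by case=> [[? _ []]|[? _ []]]. Qed.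

Definition bar (x : symbol B) : symbol B :=
  match x with inl y => inr y | inr y => inl y end.

Lemma Fop_sym x y X : x <> 0 -> Fop [set x] X y -> Fop [set y] (bar \o X) x.
Proof.
move=> x0 [[xi -> [[k [s [u /= -> ->]]] v0]]|[xi -> [[k [s Us]] v0]]].
- by right; exists xi => //; split=> //; exists k, s.
- by left; exists xi => //; split=> //; exists k, s, y.
Qed.

Lemma Fiter_sub U U' Xs : U `<=` U' -> Fiter U Xs `<=` Fiter U' Xs.
Proof.
elim: Xs U U' => [//|X Xs IH] U U' sU /=; apply: IH; exact: Fop_sub.
Qed.

Lemma FiterP U Xs v : Fiter U Xs v -> exists2 u, U u & Fiter [set u] Xs v.
Proof.
elim: Xs U => [|X Xs IH] U /=; first by move=> Uv; exists v.
move=> /IH[w /FopP[u Uu uw] h]; exists u => //=.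
by apply: Fiter_sub h => _ ->.
Qed.

Lemma Fiter_cat U Xs Ys : Fiter U (Xs ++ Ys) = Fiter (Fiter U Xs) Ys.
Proof. exact: foldl_cat. Qed.

Lemma Fiter_trans x y z Xs Ys :
  Fiter [set x] Xs y -> Fiter [set y] Ys z -> Fiter [set x] (Xs ++ Ys) z.
Proof. by move=> h1; rewrite Fiter_cat; apply: Fiter_sub => _ ->. Qed.

Lemma Fiter_sym x y Xs : x <> 0 -> Fiter [set x] Xs y ->
  exists Ys, Fiter [set y] Ys x.
Proof.
elim: Xs x => [|X Xs IH] x x0 /=.
  by move=> ->; exists [::].
move=> /FiterP[w xw wy]; have w0 := Fop_neq0 xw.
have [Ys h] := IH _ w0 wy; exists (Ys ++ [:: bar \o X]).
exact: (@Fiter_trans y w x Ys [:: bar \o X] h (Fop_sym x0 xw)).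
Qed.

Lemma Fiter_set0 Xs : Fiter set0 Xs = set0.
Proof.
by apply/seteqP; split=> // v /FiterP[u].
Qed.

Lemma connectedP e e' : conn e e' <-> exists Xs, Fiter [set e] Xs e'.
Proof.
split=> [[->|[Xs [_ _ h]]]|[Xs h]]; [by exists [::]|by exists Xs|].
case: Xs h => [->|X Xs h]; first by left.
right; exists (X :: Xs); split=> // r _.
apply/set0P/negP => /eqP h0; move: h.
rewrite -[X :: Xs](cat_take_drop r) Fiter_cat h0.
by move/FiterP => [].
Qed.

Lemma connected_trans x y z : conn x y -> conn y z -> conn x z.
Proof.
move=> /connectedP[Xs h1] /connectedP[Ys h2]; apply/connectedP.
by exists (Xs ++ Ys); exact: Fiter_trans h1 h2.
Qed.

Lemma connected_sym x y : x <> 0 -> conn x y -> conn y x.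
Proof.
by move=> x0 /connectedP[Xs h1]; apply/connectedP; exact: Fiter_sym h1.
Qed.

Hypothesis B_basis : is_basis B.
Let lB := B_basis.1.
Let BT v : lspan B v. Proof. by rewrite B_basis.2. Qed.

Lemma class_sub e : conn_class e `<=` B. Proof. by move=> x []. Qed.

Lemma class_refl e : B e -> conn_class e e. Proof. by split=> //; left. Qed.

Lemma class_eq e e' : B e -> conn_class e e' -> conn_class e = conn_class e'.
Proof.
move=> Be [Be' ee']; apply/seteqP; split=> x [Bx h]; split=> //.
  apply: connected_trans h; apply: connected_sym ee'; exact: basis_neq0 Be.
exact: connected_trans h.
Qed.

Lemma class_disj e e' x : B e -> B e' -> conn_class e x -> conn_class e' x ->
  conn_class e = conn_class e'.
Proof. by move=> Be Be' /(class_eq Be)-> /(class_eq Be')->. Qed.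

Lemma span_class_inj e e' : B e -> B e' -> lspan (conn_class e) = lspan (conn_class e') ->
  conn_class e = conn_class e'.
Proof.
move=> Be Be' E; apply: (@class_disj _ _ e) => //; first exact: class_refl.
apply: (span_basis_mem lB) => //; first exact: class_sub.
by rewrite -E; apply: sub_span; exact: class_refl.
Qed.

Lemma others_sub e : B e ->
  sumspace (summands `\ lspan (conn_class e)) `<=` lspan (B `\` conn_class e).
Proof.
move=> Be; apply: span_min; first exact: span_subspace.
move=> x [U [[_ [e' Be' <-] <-] /= Une] xU].
apply: lspan_mono xU => y ye'; split; first exact: class_sub ye'.
by move=> ye; apply: Une; rewrite (class_disj Be Be' ye ye').
Qed.

Lemma proj_unique e v p q : B e ->
  lspan (conn_class e) p -> sumspace (summands `\ lspan (conn_class e)) (v - p) ->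
  lspan (conn_class e) q -> sumspace (summands `\ lspan (conn_class e)) (v - q) -> p = q.
Proof.
move=> Be p1 p2 q1 q2; apply/eqP; rewrite -subr_eq0; apply/eqP.
have sp := @span_subspace F V.
apply: (@span_disjoint _ _ B (conn_class e) (B `\` conn_class e)) => //.
- exact: class_sub.
- by move=> x h [].
- exact: (subspaceB (sp _) p1 q1).
- apply: others_sub => //.
  have -> : p - q = (v - q) - (v - p) by rewrite opprB [RHS]addrC addrA subrK.
  exact: (subspaceB (sp _) q2 p2).
Qed.

Lemma proj_spec e v : B e ->
  lspan (conn_class e) (summand_proj summands (lspan (conn_class e)) v) /\
  sumspace (summands `\ lspan (conn_class e)) (v - summand_proj summands (lspan (conn_class e)) v).
Proof.
move=> Be; rewrite /summand_proj.
apply: (@xgetPex _ 0 [set p | lspan (conn_class e) p /\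
  sumspace (summands `\ lspan (conn_class e)) (v - p)]).
have sp := @span_subspace F V.
have ssp (D : set (set V)) : is_subspace (sumspace D) by exact: sp.
pose P v := exists p, lspan (conn_class e) p /\
  sumspace (summands `\ lspan (conn_class e)) (v - p).
apply: (@span_min _ _ B P _ _ v); last exact: BT.
  apply/subspaceP; split.
    by exists 0; rewrite subrr; split; apply: subspace0.
  move=> a x y [p [p1 p2]] [q [q1 q2]]; exists (a *: p + q); split.
    exact: (subspaceZD a (sp _) p1 q1).
  have -> : a *: x + y - (a *: p + q) = a *: (x - p) + (y - q).
    by rewrite scalerBr opprD addrACA.
  exact: (subspaceZD a (ssp _) p2 q2).
move=> b Bb; case: (pselect (conn_class e b)) => eb.
  exists b; rewrite subrr; split; first exact: sub_span.
  exact: subspace0.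
exists 0; rewrite subr0; split; first exact: subspace0.
apply: sub_span; exists (lspan (conn_class b)); last exact: sub_span (class_refl Bb).
split; first by exists (conn_class b) => //; exists b.
move=> /= /(span_class_inj Bb Be) E; apply: eb; rewrite -E; exact: class_refl.
Qed.

Lemma span_proj v (D : set V) : D `<=` B -> 
  (forall e, B e -> summand_proj summands (lspan (conn_class e)) v <> 0 -> conn_class e `<=` D) ->
  lspan D v.
Proof.
move=> DB h.
have [s [a [us sB a0 ve]]] := span_comb (BT v).
rewrite ve big_seq; apply: big_ind.
- exact: (subspace0 (span_subspace _)).
- by move=> x y xD yD; exact: (subspaceD (span_subspace _) xD yD).
move=> b bs; case: (pselect (a b = 0)) => [->|ab].
  rewrite scale0r; exact: (subspace0 (span_subspace _)).
apply: (subspaceZ _ (span_subspace _)).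
apply: sub_span; have Bb := sB _ bs.
apply: (h b) => //; last exact: class_refl.
move=> p0; have [_] := proj_spec v Bb; rewrite p0 subr0 => /(others_sub Bb) vO.
apply: ab.
have vO' : lspan (B `\ b) v.
  apply: lspan_mono vO => x [Bx nx]; split=> //= xb.
  by apply: nx; rewrite xb; exact: class_refl.
have sp := @span_subspace F V.
suff abb : a b *: b = 0.
  apply/eqP; move/eqP: abb; rewrite scaler_eq0 => /orP[//|/eqP b0].
  by case: (basis_neq0 lB Bb).
apply: (@span_disjoint _ _ B [set b] (B `\ b)) => //.
- by move=> _ ->.
- by move=> x ->; case=> _; apply.
- apply: (subspaceZ _ (sp _)); exact: sub_span.
- have -> : a b *: b = v - \sum_(x <- s | x != b) a x *: x.
    by rewrite ve (bigD1_seq b) //= addrK.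
  apply: (subspaceB (sp _) vO'); rewrite big_seq_cond; apply: big_ind.
  + exact: (subspace0 (sp _)).
  + by move=> x y xD yD; exact: (subspaceD (sp _) xD yD).
  + move=> x /andP[xs xb]; apply: (subspaceZ _ (sp _)); apply: sub_span.
    by split; [exact: sB|exact/eqP].
Qed.

Hypothesis f_lin : multilinear f.


(* two distinct basic entries of a nonzero value are conn *)
Lemma f_connected (a : 'I_n -> V) : (forall i, B (a i)) -> f a <> 0 ->
  forall k l, conn_class (a k) (a l).
Proof.
move=> aB fa0 k l; split=> //; apply/connectedP.
pose xi k j : B := SigSub (mem_set (aB (lift k j))).
have aE m : a = insert_at m (a m) (permuted (xi m) 1%g).
  rewrite -[LHS](insertE m); congr insert_at; apply: funext => j.
  by rewrite /permuted perm1.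
exists [:: (fun j => inl (xi k j)); (fun j => inr (xi l j))] => /=.
right; exists (xi l) => //; split; last exact: basis_neq0 lB (aB l).
exists l, 1%g; rewrite -aE; left; exists (xi k) => //; split=> //.
by exists k, 1%g, (a k) => //; rewrite -aE.
Qed.


Lemma linked_approx (n_gt1 : (1 < n)%N) e e' e'' : B e -> B e' -> B e'' ->
  approx f B e e' -> linked f B (conn_class e') (conn_class e'') ->
  approx f B e e''.
Proof.
move=> Be Be' Be'' ee' L; right; case: ee' => [/(span_class_inj Be Be') E|].
  exists 1%N, (fun r => if r == 0%N then conn_class e else conn_class e'').
  split=> //; last by move=> [|//] _; rewrite /= E.
  by move=> r _; case: ifP => _; [exists e|exists e''].
move=> [m [c [c1 c2 c3 c4]]].
exists m.+1, (fun r => if (r <= m)%N then c r else conn_class e''); split.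
- by move=> r _; case: ifP => [/c1//|_]; exists e''.
- by [].
- by rewrite ltnn.
- move=> r; rewrite ltnS leq_eqVlt => /orP[/eqP->|rm].
    by rewrite eqxx ltnn /= c3.
  by rewrite rm orbT; apply: c4.
Qed.

Lemma component_strongly_invariant (n_gt1 : (1 < n)%N) e : B e ->
  strongly_invariant f (component_of f B e).
Proof.
move=> Be; split=> [|k]; first exact: span_subspace.
pose D := \bigcup_(e' in [set e' | B e' /\ approx f B e e']) conn_class e'.
have DB : D `<=` B by move=> x [e' _ [Bx _]].
have CD : component_of f B e `<=` lspan D.
  apply: span_min; first exact: span_subspace.
  move=> x [_ [e' e'P <-] xe']; apply: lspan_mono xe' => y ye'; by exists e'.
have DC : lspan D `<=` component_of f B e.
  apply: span_min; first exact: span_subspace.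
  move=> x [e' e'P xe']; apply: sub_span; exists (lspan (conn_class e')).
    by exists e'.
  exact: sub_span.
apply: span_min; first exact: span_subspace.
move=> _ [a ha <-]; apply: DC.
apply: (@multilinear_span _ _ _ f (fun i => if i == k then D else B)) => //.
- exact: span_subspace.
- move=> {ha} {}a ha.
  have aB i : B (a i) by move: (ha i); case: ifP => // _ /DB.
  have := ha k; rewrite eqxx => -[e' [Be' ee'] ke'].
  case: (pselect (f a = 0)) => [->|fa0]; first exact: (subspace0 (span_subspace _)).
  have E : conn_class e' = conn_class (a k) by exact: class_eq.
  have ae' i : conn_class e' (a i) by rewrite E; exact: f_connected.
  apply: (span_proj DB) => e'' Be'' pne0 x xe''; exists e'' => //; split=> //.
  apply: (linked_approx n_gt1 Be Be' Be'' ee') => L.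
  apply: pne0; suff : [set 0 : V] (summand_proj summands (lspan (conn_class e'')) (f a)).
    by [].
  rewrite -L; apply: sub_span.
  pose k1 := Ordinal (ltnW n_gt1); pose k2 := Ordinal n_gt1.
  pose L' := lspan (conn_class e').
  exists (summand_proj summands (lspan (conn_class e'')) @`
          fspan f (slot2 k1 L' k2 L')).
    by exists k1, k2; split=> //; right.
  exists (f a) => //; apply: sub_span; exists a => // i; rewrite /slot2.
  have H : L' (a i) by exact: (sub_span (ae' i)).
  by case: ifP => // _; case: ifP.
- move=> i; have := ha i; rewrite /slot; case: eqP => [_ /CD //|_ _]; exact: BT.
Qed.

End ComponentLemmas.

Lemma component_stable (F : fieldType) (V : lmodType F) (n : nat)
    (f : ('I_n -> V) -> V) (B : set V) (e : V) (n_gt1 : (2 <= n)%N)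
    (f_lin : multilinear f) (B_basis : is_basis B) (Be : B e) (a : 'I_n -> V) :
  (forall i, component_of f B e (a i)) -> component_of f B e (f a).
Proof.
move=> ha; have [_ h] := component_strongly_invariant B_basis f_lin n_gt1 Be.
apply: (h (Ordinal n_gt1)); apply: sub_span; exists a => // i.
by rewrite /slot; case: ifP.
Qed.

(* Main.v *)
Require Import Defs.
From HB Require Import structures.
From mathcomp Require Import all_boot all_order all_algebra all_fingroup.
From mathcomp Require Import boolp classical_sets.

(** The equivalence holds for every nonzero space with a basis and an
    [n]-linear map [g], [n >= 2] ([simple_iff_division_basis]); a component is
    nonzero because it contains [e], and [B] restricts to a basis of it because
    it is spanned by elements of [B] ([restricted_basis]).

    If the space is simple, the annihilator is a strongly invariant subspace
    which is proper since [g <> 0], hence zero; and every [I(w)] with [w <> 0]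
    is the whole space, so the division property is automatic.

    Conversely, let [U] be strongly invariant and [u] a nonzero element of it.
    As [u] is not in the annihilator, some value [w = g a] with [a k = u] is
    nonzero, and by linearity in another entry [j] we may take [a j] in the
    basis.  The division property then applies to every nonzero value having
    the entry [a j] in place [j]: it puts all the entries in the ideal of the
    value.  For an arbitrary [x], put [x] in place of [u] in [a].
    - If the new value is nonzero, it lies in [U], because [a j] does
      ([a j] is in [I(w)], which is contained in [U]); so [x] lies in [U].
    - If the new value is zero, then [u + x] in place of [u] still gives [w],
      so [u + x] lies in [I(w)], hence in [U], and so does [x].
    Thus [U] is the whole space ([division_invariant_full]). *)

Set Implicit Arguments.
Unset Strict Implicit.
Unset Printing Implicit Defensive.

Import GRing.Theory.
Local Open Scope classical_set_scope.
Local Open Scope ring_scope.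

Section DivisionBases.
Variables (F : fieldType) (V : lmodType F) (n : nat).
Variable g : ('I_n -> V) -> V.
Implicit Types (B U W : set V) (u v w x : V) (a : 'I_n -> V) (j k : 'I_n).

Lemma subspace_set0 : is_subspace [set 0 : V].
Proof.
by apply/subspaceP; split=> // c u v -> ->; rewrite scaler0 addr0.
Qed.

Lemma strongly_invariantP W :
  strongly_invariant g W <->
  is_subspace W /\ forall a k, W (a k) -> W (g a).
Proof.
split=> -[sW h]; split=> //.
  move=> a k ak; apply: (h k); apply: Defs.sub_span; exists a => // i.
  by rewrite /slot; case: eqP => [->|].
move=> k; apply: span_min => // _ [a ha <-]; apply: (h a k).
by have := ha k; rewrite /slot eqxx.
Qed.

Lemma AnnP v : Ann g v <-> forall a k, a k = v -> g a = 0.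
Proof.
split=> [h a k akv|h k].
  have : fspan g (slot k [set v]) (g a).
    apply: Defs.sub_span; exists a => // i.
    by rewrite /slot; case: eqP => [->|].
  by rewrite h.
apply/seteqP; split=> [|_ ->]; last exact: (subspace0 (span_subspace _)).
apply: span_min; first exact: subspace_set0.
by move=> _ [a ha <-]; apply: (h a k); have := ha k; rewrite /slot eqxx.
Qed.

Lemma ideal_gen_invariant w : strongly_invariant g (ideal_gen g w).
Proof.
apply/strongly_invariantP; split.
  apply/subspaceP; split=> [W [[sW _] _]|c u v hu hv W WP].
    exact: subspace0.
  by case: (WP) => -[sW _] _; apply: subspaceZD; [|exact: hu|exact: hv].
move=> a k h W WP; case: (WP) => /strongly_invariantP[_ hW] _.
exact: (hW a k (h W WP)).
Qed.

Lemma ideal_gen_self w : ideal_gen g w w.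
Proof. by move=> W [_]; apply. Qed.

Lemma ideal_gen_min w W : strongly_invariant g W -> W w -> ideal_gen g w `<=` W.
Proof. by move=> iW Ww; apply: smallest_sub => // _ ->. Qed.

(** The division property for a whole tuple: any place may be the one that
    holds the basis vector. *)
Lemma i_division_entries B a j i : i_division g B -> B (a j) -> g a <> 0 ->
  ideal_gen g (g a) (a i).
Proof.
move=> dB Baj ga0; have := dB (a j) (fun l => a (lift j l)) j Baj.
rewrite insertE => /(_ ga0)[hj hl].
by case: (unliftP j i) => [l ->|->].
Qed.

Definition replace_at a k x : 'I_n -> V :=
  insert_at k x (fun l => a (lift k l)).

Lemma replace_at_self a k : replace_at a k (a k) = a.
Proof. exact: insertE. Qed.

Lemma replace_at_eq a k x : replace_at a k x k = x.
Proof. exact: insert_id. Qed.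

Lemma replace_at_neq a k x j : j != k -> replace_at a k x j = a j.
Proof.
case: (unliftP k j) => [l ->|->]; last by rewrite eqxx.
by move=> _; rewrite /replace_at insert_lift.
Qed.

Hypothesis g_lin : multilinear g.

Lemma multilinear_replaceD a k u v :
  g (replace_at a k (u + v)) = g (replace_at a k u) + g (replace_at a k v).
Proof.
by have := g_lin k (fun l => a (lift k l)) 1 u v; rewrite !scale1r.
Qed.

Lemma multilinear_replace_preim_subspace a k W :
  is_subspace W -> is_subspace [set x | W (g (replace_at a k x))].
Proof.
move=> sW; have gl := g_lin k (fun l => a (lift k l)).
apply/subspaceP; split=> [|c u v /= uW vW]; last first.
  by rewrite /replace_at gl; exact: subspaceZD.
have /= := gl (-1) 0 0; rewrite scaler0 addr0 scaleN1r addNr /replace_at => ->.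
exact: subspace0.
Qed.

(** A linear map vanishing on a basis vanishes, applied to the [j]-th entry. *)
Lemma basis_entry B a j : is_basis B -> g a <> 0 ->
  exists2 b, B b & g (replace_at a j b) <> 0.
Proof.
move=> [_ BT] ga0; apply: contrapT => nex; apply: ga0.
rewrite -(replace_at_self a j).
apply: (@span_min _ _ B [set x | g (replace_at a j x) = 0]); last by rewrite BT.
  exact: multilinear_replace_preim_subspace subspace_set0.
by move=> b Bb /=; apply: contrapT => gb; apply: nex; exists b.
Qed.

Lemma Ann_subspace : is_subspace (Ann g).
Proof.
apply/subspaceP; split=> [|c u v /AnnP hu /AnnP hv]; apply/AnnP => a k ak;
  rewrite -(replace_at_self a k) ak.
  exact: subspace0 (multilinear_replace_preim_subspace a k subspace_set0).
apply: (subspaceZD c (multilinear_replace_preim_subspace a k subspace_set0)) => /=.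
  by apply: (hu _ k); rewrite replace_at_eq.
by apply: (hv _ k); rewrite replace_at_eq.
Qed.

Lemma Ann_invariant : strongly_invariant g (Ann g).
Proof.
apply/strongly_invariantP; split=> [|a k /AnnP/(_ a k erefl) ->].
  exact: Ann_subspace.
exact: (subspace0 Ann_subspace).
Qed.

Lemma fspan_setT_eq0 : (forall a, g a = 0) -> fspan g (fun=> setT) = [set 0].
Proof.
move=> g0; apply/seteqP; split=> [|_ ->]; last exact: (subspace0 (span_subspace _)).
by apply: span_min; [exact: subspace_set0|move=> _ [a _ <-]; exact: g0].
Qed.

(** An element [u] of [U] outside the annihilator, together with a basis vector
    in another entry, lets the division property recover every vector [x]. *)
Lemma division_invariant_full B U u : (1 < n)%N -> is_basis B ->
  i_division g B -> strongly_invariant g U -> U u -> ~ Ann g u -> U = setT.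
Proof.
move=> n_gt1 bB dB iU Uu nAu; have [sU hU] := (strongly_invariantP U).1 iU.
have [a [k [aku ga0]]] : exists a k, a k = u /\ g a <> 0.
  apply: contrapT => nex; apply: nAu; apply/AnnP => a k aku.
  by apply: contrapT => ga0; apply: nex; exists a, k.
have [j jk] : exists j, j != k.
  pose k1 := Ordinal (ltnW n_gt1); pose k2 := Ordinal n_gt1.
  by case: (eqVneq k1 k) => [<-|]; [exists k2|exists k1].
have [b Bb] := basis_entry j bB ga0.
set a' := replace_at a j b => ga'0.
have a'j : a' j = b by rewrite /a' replace_at_eq.
have a'k : a' k = u by rewrite /a' replace_at_neq // eq_sym.
have Uga' : U (g a') by apply: (hU _ k); rewrite a'k.
have IU i y : U (g (replace_at a' k y)) -> g (replace_at a' k y) <> 0 ->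
    U (replace_at a' k y i).
  move=> Uy gy0; apply: (ideal_gen_min iU Uy).
  by apply: (i_division_entries (j := j) _ dB) gy0; rewrite replace_at_neq // a'j.
have Ub : U (a' j).
  by have := IU j u; rewrite -a'k replace_at_self; apply.
apply/seteqP; split=> // x _.
case: (pselect (g (replace_at a' k x) = 0)) => [gx0|gx0].
  have gux : g (replace_at a' k (u + x)) = g a'.
    by rewrite multilinear_replaceD gx0 addr0 -a'k replace_at_self.
  rewrite -(addKr u x) addrC; apply: subspaceB => //.
  by rewrite -[u + x](replace_at_eq a' k); apply: IU; rewrite gux.
rewrite -[x](replace_at_eq a' k); apply: IU => //; apply: (hU _ j).
by rewrite replace_at_neq.
Qed.

Theorem simple_iff_division_basis B : (1 < n)%N -> is_basis B ->
  (exists v, v <> 0) ->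
  f_simple g <-> Ann g = [set 0] /\ i_division_basis g B.
Proof.
move=> n_gt1 bB [v0 v00]; pose k0 := Ordinal n_gt1.
split=> [[gT simple]|[A0 [_ dB]]]; split.
- case: (simple _ Ann_invariant) => // AT; case: gT; apply: fspan_setT_eq0 => a.
  have : Ann g (a k0) by rewrite AT.
  by move/AnnP; apply.
- split=> // x b k _ w0.
  case: (simple _ (ideal_gen_invariant (g (insert_at k x b)))) => [I0|->] //.
  by have := @ideal_gen_self (g (insert_at k x b)); rewrite I0.
- move=> g0; apply: v00; suff : Ann g v0 by rewrite A0.
  apply/AnnP => a k _.
  have : fspan g (fun=> setT) (g a) by apply: Defs.sub_span; exists a.
  by rewrite g0.
- move=> U iU; case: (pselect (exists2 u, U u & u <> 0)) => [[u Uu u0]|nex].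
    right; apply: (division_invariant_full n_gt1 bB dB iU Uu).
    by rewrite A0.
  left; apply/seteqP; split=> [u Uu|_ ->]; last exact: (subspace0 iU.1).
  by apply: contrapT => u0; apply: nex; exists u.
Qed.

End DivisionBases.

Section Restriction.
Variables (F : fieldType) (V : lmodType F).
Implicit Types (A B : set V).

Lemma restriction_multilinear n (f : ('I_n -> V) -> V) A
    (fA : forall a, (forall i, lspan A (a i)) -> lspan A (f a)) :
  multilinear f -> multilinear (restriction fA).
Proof.
move=> f_lin k b c u v; apply: val_inj.
have val_restr w : val (restriction fA (insert_at k w b)) =
    f (insert_at k (val w) (fun j => val (b j))).
  by rewrite /=; congr f; apply: funext => i; rewrite /insert_at; case: unlift.
have valP c' x y : val (c' *: x + y : span_type A) = c' *: val x + val y.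
  exact: linearP.
by rewrite valP !val_restr valP f_lin.
Qed.

Lemma restricted_lin_indep A B :
  lin_indep B -> lin_indep [set v : span_type A | B (val v)].
Proof.
move=> lB s us sB c s0 v vs.
(* the coefficients extended by 0 to vectors outside the subspace *)
pose c' x := if insub x is Some y then c y else 0.
have c'E (y : span_type A) : c' (val y) = c y by rewrite /c' valK.
rewrite -c'E; apply: (lB (map val s)).
- by rewrite map_inj_uniq //; exact: val_inj.
- by move=> _ /mapP[y /sB By ->].
- rewrite big_map; transitivity (val (\sum_(y <- s) c y *: y)).
    by rewrite linear_sum; apply: eq_bigr => y _; rewrite c'E linearZ.
  by rewrite s0 linear0.
- exact: map_f.
Qed.

Lemma restricted_basis A B : is_basis B -> A `<=` lspan (B `&` lspan A) ->
  is_basis [set v : span_type A | B (val v)].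
Proof.
move=> [lB _] AB; split; first exact: restricted_lin_indep.
set B' := [set v : span_type A | B (val v)].
apply/seteqP; split=> // v _.
have [y /val_inj <- //] : exists2 y : span_type A, val y = val v & lspan B' y.
have sB' := span_subspace B'.
apply: (@span_min _ _ (B `&` lspan A)
          (fun x => exists2 y : span_type A, val y = x & lspan B' y)).
- apply/subspaceP; split; first by exists 0; [exact: linear0|exact: (subspace0 sB')].
  move=> c _ _ [y <- hy] [z <- hz].
  by exists (c *: y + z); [exact: linearP|exact: (subspaceZD c sB')].
- move=> x [Bx Ax]; exists (SpanVec (mem_set Ax)) => //.
  exact: Defs.sub_span.
- apply: (span_min _ AB); first exact: span_subspace.
  exact: set_mem (valP v).
Qed.

End Restriction.

Lemma component_gens_basis (F : fieldType) (V : lmodType F) (n : nat)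
    (f : ('I_n -> V) -> V) (B : set V) (e : V) :
  component_gens f B e `<=` lspan (B `&` component_of f B e).
Proof.
move=> x [U UP xU]; case: (UP) => e' _ UE; rewrite -UE in xU.
apply: lspan_mono xU => y ye'; split; first exact: class_sub ye'.
by apply: Defs.sub_span; exists U => //; rewrite -UE; exact: Defs.sub_span.
Qed.

Theorem theorem4p2 (F : fieldType) (V : lmodType F) (n : nat)
    (n_gt1 : (2 <= n)%N) (f : ('I_n -> V) -> V) (f_lin : multilinear f)
    (B : set V) (B_basis : is_basis B) (e : V) (Be : B e) :
  let f' := restriction (component_stable n_gt1 f_lin B_basis Be) in
  let B' := [set v | B (val v)] in
  f_simple f' <-> Ann f' = [set 0] /\ i_division_basis f' B'.
Proof.
move=> f' B'; apply: simple_iff_division_basis => //.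
- exact: restriction_multilinear.
- exact: restricted_basis (@component_gens_basis _ _ _ _ _ _).
- have eC : component_of f B e e.
    apply: Defs.sub_span; exists (lspan (conn_class f B e)).
      by exists e => //; split=> //; left.
    by apply: Defs.sub_span; exact: Defs.class_refl.
  exists (SpanVec (mem_set eC)) => e0; apply: (basis_neq0 B_basis.1 Be).
  by have := congr1 val e0; rewrite linear0.
Qed.
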